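(* Let $R$ be a commutative ring of Krull dimension at most $1$ such that $\operatorname{mSpec}R$ (with the Zariski topology) is a Noetherian space, and let $A$ be an $R$-algebra which is finitely generated as an $R$-module. Let $h$ be the smallest non-negative integer such that $h\ge r_{\mathfrak p}$ for all but finitely many maximal ideals $\mathfrak p$ of $R$. If $k$ is an integer with $k\ge r_{\mathfrak p}$ for all maximal ideals $\mathfrak p$ and $k\ge 1+h$, then $A$ can be generated by $k$ elements as an $R$-algebra.
   Context: Algebras are associative and unital; elements generate an algebra if the non-commutative monomials in them (including $1$) span it as a module. For a prime ideal $\mathfrak p$, $\kappa(\mathfrak p)=R_{\mathfrak p}/\mathfrak pR_{\mathfrak p}$ and $r_{\mathfrak p}$ is the smallest number of generators of the $\kappa(\mathfrak p)$-algebra $A\otimes_R\kappa(\mathfrak p)$. *)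

(* Defs.v *)
From HB Require Import structures.
From mathcomp Require Import all_boot all_order all_algebra.
From Stdlib Require List.
Set Implicit Arguments. Unset Strict Implicit. Unset Printing Implicit Defensive.
Import GRing.Theory.
Local Open Scope ring_scope.

Section CommAlg.
Variable R : comPzRingType.

Definition is_ideal (I : R -> Prop) : Prop :=
  [/\ I 0, (forall x y, I x -> I y -> I (x + y)) & (forall r x, I x -> I (r * x))].

Definition is_prime (P : R -> Prop) : Prop :=
  [/\ is_ideal P, ~ P 1 & (forall a b, P (a * b) -> P a \/ P b)].

Definition is_maximal (M : R -> Prop) : Prop :=
  [/\ is_ideal M, ~ M 1 &
      (forall J : R -> Prop, is_ideal J -> (forall x, M x -> J x) ->
         (forall x, J x <-> M x) \/ J 1)].

Definition strict_incl (I J : R -> Prop) : Prop :=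
  (forall x, I x -> J x) /\ (exists x, J x /\ ~ I x).

Definition krull_dim_le1 : Prop :=
  forall p0 p1 p2 : R -> Prop, is_prime p0 -> is_prime p1 -> is_prime p2 ->
    strict_incl p0 p1 -> strict_incl p1 p2 -> False.

(* Zariski-closed subsets of mSpec R: V(S) = {m maximal | S ⊆ m}. *)
Definition inV (S : R -> Prop) (m : R -> Prop) : Prop := forall x, S x -> m x.

Definition mSpec_noetherian : Prop :=
  forall S : nat -> (R -> Prop),
    (forall n m, is_maximal m -> inV (S n.+1) m -> inV (S n) m) ->
    exists N, forall n, (N <= n)%N ->
      forall m, is_maximal m -> (inV (S n) m <-> inV (S N) m).

Variable A : algType R.

Definition fg_module : Prop :=
  exists s : seq A, forall a : A,
    exists c : 'I_(size s) -> R, a = \sum_(i < size s) c i *: s`_i.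

Definition monomial (n : nat) (x : 'I_n -> A) (w : seq 'I_n) : A :=
  \prod_(i <- w) x i.

Definition alg_generated_by (n : nat) (x : 'I_n -> A) : Prop :=
  forall a : A, exists l : seq (R * seq 'I_n),
    a = \sum_(t <- l) t.1 *: monomial x t.2.

Definition alg_gen (n : nat) : Prop := exists x : 'I_n -> A, alg_generated_by x.

(* ---- The fibre A ⊗_R κ(p), κ(p) = R_p / p R_p. ----
   We use the standard presentation A ⊗_R κ(p) = A_p / p A_p: an element is
   represented by a pair (a, s) with a ∈ A, s ∉ p (standing for a/s), and
   (a, s) ~ (b, t) iff u (t a - s b) ∈ pA for some u ∉ p.  Elements of κ(p)
   are likewise pairs (r, d) with d ∉ p, acting by (r/d)(a/s) = (r a)/(d s). *)

Definition in_pA (p : R -> Prop) (a : A) : Prop :=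
  exists l : seq (R * A), (forall t, List.In t l -> p t.1) /\
                          a = \sum_(t <- l) t.1 *: t.2.

Definition fib_eq (p : R -> Prop) (x y : A * R) : Prop :=
  exists u : R, ~ p u /\ in_pA p (u *: (y.2 *: x.1 - x.2 *: y.1)).

Definition fib_add (x y : A * R) : A * R := (y.2 *: x.1 + x.2 *: y.1, x.2 * y.2).
Definition fib_mul (x y : A * R) : A * R := (x.1 * y.1, x.2 * y.2).
Definition fib_scale (c : R * R) (x : A * R) : A * R := (c.1 *: x.1, c.2 * x.2).
Definition fib_zero : A * R := (0, 1).
Definition fib_one : A * R := (1, 1).

Definition fib_monomial (n : nat) (y : 'I_n -> A * R) (w : seq 'I_n) : A * R :=
  foldr (fun i acc => fib_mul (y i) acc) fib_one w.

Definition fib_alg_gen (p : R -> Prop) (n : nat) : Prop :=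
  exists y : 'I_n -> A * R, (forall i, ~ p (y i).2) /\
    forall z : A * R, ~ p z.2 ->
      exists l : seq ((R * R) * seq 'I_n),
        (forall t, List.In t l -> ~ p t.1.2) /\
        fib_eq p z (foldr (fun t acc => fib_add (fib_scale t.1 (fib_monomial y t.2)) acc)
                          fib_zero l).

Definition is_rp (p : R -> Prop) (r : nat) : Prop :=
  fib_alg_gen p r /\ forall n, fib_alg_gen p n -> (r <= n)%N.

Definition cofinite_bound (h : nat) : Prop :=
  exists L : seq (R -> Prop),
    forall p, is_maximal p ->
      ~ (exists q, List.In q L /\ forall x, p x <-> q x) ->
      forall r, is_rp p r -> (r <= h)%N.

Definition is_h (h : nat) : Prop :=
  cofinite_bound h /\ forall h', cofinite_bound h' -> (h <= h')%N.

End CommAlg.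

(* Main.v *)
(** Write [c_m(xs)] for the number of further elements needed to generate [A/mA]
    starting from the list [xs]; by Nakayama [c_m] is upper semicontinuous on
    mSpec R.  The generators are chosen one at a time so that, after [j] steps,
    [c_m <= k - j] everywhere and [c_m <= h - j] off a finite set [F].  By the
    Chinese remainder theorem the next element can be prescribed on [F] and at
    one point outside [F] of each infinite irreducible component of mSpec R.
    As dim R <= 1, the points where [c_m <= h - j - 1] then fails form a finite
    set, and at those outside [F] one still has [c_m <= h - j <= k - j - 1]:
    this is where [k >= 1 + h] enters.  After [h] steps only finitely many
    maximal ideals remain to be corrected, again by the Chinese remainder
    theorem. *)
Require Import Defs.
From HB Require Import structures.
From mathcomp Require Import all_boot all_order all_algebra.
From mathcomp Require Import boolp classical_sets.
From Stdlib Require List.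
Set Implicit Arguments. Unset Strict Implicit. Unset Printing Implicit Defensive.
Import GRing.Theory.
Local Open Scope ring_scope.

(** * Ideals, maximal ideals and comaximality *)

Section Ideals.
Variable R : comPzRingType.
Implicit Types (I p q m S : R -> Prop) (L : seq (R -> Prop)) (r s t u : R).

Lemma ideal0 I : is_ideal I -> I 0. Proof. by case. Qed.
Lemma idealD I r s : is_ideal I -> I r -> I s -> I (r + s).
Proof. by case=> _ + _; apply. Qed.
Lemma idealM I r s : is_ideal I -> I s -> I (r * s).
Proof. by case=> _ _; apply. Qed.
Lemma idealMr I r s : is_ideal I -> I r -> I (r * s).
Proof. by rewrite mulrC; exact: idealM. Qed.
Lemma idealN I r : is_ideal I -> I r -> I (- r).
Proof. by move=> hI hr; rewrite -mulN1r; exact: idealM. Qed.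

Lemma maximal_ideal m : is_maximal m -> is_ideal m. Proof. by case. Qed.
Lemma prime_ideal p : is_prime p -> is_ideal p. Proof. by case. Qed.

(** Maximality is applied to the ideal [m + rR], which strictly contains [m] and so contains 1. *)
Lemma maximal_inv m r : is_maximal m -> ~ m r -> exists s, m (1 - r * s).
Proof.
move=> [mI m1 mmax] mr.
have hJ : is_ideal (fun x => exists a, m (x - r * a)).
  split=> [|x y [a ha] [b hb]|c x [a ha]].
  - by exists 0; rewrite mulr0 subr0; exact: ideal0.
  - by exists (a + b); rewrite mulrDr opprD addrACA; exact: idealD.
  - by exists (c * a); rewrite mulrCA -mulrBr; exact: idealM.
case: (mmax _ hJ) => [x mx|E|[s hs]]; last by exists s.
- by exists 0; rewrite mulr0 subr0.
- by case: mr; apply/E; exists 1; rewrite mulr1 subrr; exact: ideal0.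
Qed.

Lemma maximal_prime m : is_maximal m -> is_prime m.
Proof.
move=> hm; have mI := maximal_ideal hm; split=> // [|a b mab]; first by case: hm.
case: (EM (m a)) => [|na]; [by left|right].
have [s hs] := maximal_inv hm na.
have -> : b = b * (1 - a * s) + s * (a * b).
  by rewrite mulrBr mulr1 [b * _]mulrCA mulrA [s * (a * b)]mulrCA (mulrC s) mulrA subrK.
by apply: idealD => //; exact: idealM.
Qed.

Lemma prime_notM p r s : is_prime p -> ~ p r -> ~ p s -> ~ p (r * s).
Proof. by case=> _ _ pP nr ns /pP[]. Qed.

Lemma maximal_sub p m : is_maximal p -> is_maximal m -> (forall x, p x -> m x) -> p = m.
Proof.
move=> [_ _ pmax] [mI m1 _] pm.
by case: (pmax m mI pm) => // E; rewrite predeqE => x; split=> /E.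
Qed.

Lemma exists_maximal I : is_ideal I -> ~ I 1 ->
  exists m, is_maximal m /\ forall x, I x -> m x.
Proof.
(* Zorn's lemma here also tests the empty chain; requiring [I] united with [X] to be a proper ideal
   makes its union correspond to [I] itself. *)
move=> hI I1; pose U (X : set R) := (I `|` X)%classic.
have [F FP totF|X [[XI X1] Xmax]] := @Zorn_bigcup R (fun X => is_ideal (U X) /\ ~ U X 1).
  have up x : U (\bigcup_(X in F) X)%classic x -> I x \/ exists2 X, F X & U X x.
    by case=> [|[X FX Xx]]; [left|right; exists X => //; right].
  have dn X x : F X -> U X x -> U (\bigcup_(X in F) X)%classic x.
    by move=> FX [|Xx]; [left|right; exists X].
  split; last by case/up => // -[X FX]; case: (FP _ FX).
  split=> [|x y|r x].
  - by left; exact: ideal0.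
  - move=> /up[Ix|[X FX Xx]] /up[Iy|[Y FY Yy]].
    + by left; exact: idealD.
    + by apply: (dn Y) => //; apply: idealD => //; [case: (FP _ FY)|left].
    + by apply: (dn X) => //; apply: idealD => //; [case: (FP _ FX)|left].
    + have [XY|YX] := totF _ _ FX FY.
      * apply: (dn Y) => //; apply: idealD => //; first by case: (FP _ FY).
        by case: Xx => [|/XY]; [left|right].
      * apply: (dn X) => //; apply: idealD => //; first by case: (FP _ FX).
        by case: Yy => [|/YX]; [left|right].
  - move=> /up[Ix|[X FX Xx]]; first by left; exact: idealM.
    by apply: (dn X) => //; apply: idealM => //; case: (FP _ FX).
exists (U X); split; last by move=> x; left.
split=> // J JI XJ; case: (EM (J 1)) => [|J1]; [by right|left].
apply: contrapT => nE.
have UJ : U J = J.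
  by rewrite predeqE => x; split=> [[Ix|//]|]; [apply: XJ; left|right].
apply: (Xmax J); last by rewrite UJ; split.
split; first by move=> x Xx; apply: XJ; right.
by move=> JX; apply: nE => x; split=> [/JX|]; [right|exact: XJ].
Qed.

(** Each maximal [q <> m] has an element outside [m]; the product of these stays outside the prime
    [m], and an inverse modulo [m] normalises it to 1. *)
Lemma crt_element m L : is_maximal m ->
  exists e, m (1 - e) /\
    forall q, List.In q L -> is_maximal q -> q <> m -> q e.
Proof.
move=> hm; have mI := maximal_ideal hm; have mP := maximal_prime hm.
suff [e [ne he]] : exists e, ~ m e /\
    forall q, List.In q L -> is_maximal q -> q <> m -> q e.
  have [s hs] := maximal_inv hm ne; exists (e * s); split=> // q Lq hq qm.
  by apply: idealMr (he _ Lq hq qm); exact: maximal_ideal.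
elim: L => [|q L [e [ne he]]]; first by exists 1; split=> //; case: hm.
case: (EM (is_maximal q /\ q <> m)) => [[hq qm]|nq]; last first.
  by exists e; split=> // q' [<- h1 h2|]; [by case: nq|exact: he].
have [f [qf mf]] : exists f, q f /\ ~ m f.
  apply: contrapT => nf; apply: qm; apply: maximal_sub => // x qx.
  by apply: contrapT => nx; apply: nf; exists x.
exists (e * f); split; first exact: prime_notM.
move=> q' [<-|Lq'] h1 h2; first by apply: idealM => //; exact: maximal_ideal.
by apply: idealMr; [exact: maximal_ideal|exact: he].
Qed.

(** * Noetherian induction on closed subsets of mSpec R *)

Definition finite_V S : Prop :=
  exists L, forall m, is_maximal m -> inV S m -> List.In m L.

Definition V_lt S T : Prop :=
  (forall m, is_maximal m -> inV S m -> inV T m) /\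
  exists m, [/\ is_maximal m, inV T m & ~ inV S m].

(** A counterexample would start, by choice, an infinite strictly descending chain of closed
    sets. *)
Lemma V_induction (P : (R -> Prop) -> Prop) : mSpec_noetherian R ->
  (forall T, (forall S, V_lt S T -> P S) -> P T) -> forall T, P T.
Proof.
move=> noeth step T0; apply: contrapT => nP0.
pose X := {T | ~ P T}.
have next (T : X) : exists S : X, V_lt (sval S) (sval T).
  case: T => T nPT /=; apply: contrapT => nS; apply: nPT; apply: step => S ST.
  by apply: contrapT => nPS; apply: nS; exists (exist _ S nPS).
have [g hg] := choice next.
pose u n := sval (iter n g (exist _ T0 nP0)).
have [N hN] := noeth u (fun n m hm => (hg _).1 m hm).
have [_ [m [hm h1 h2]]] := hg (iter N g (exist _ T0 nP0)).
by apply: h2; apply/(hN N.+1 (leqnSn N) m hm).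
Qed.

(** The ideal of the closed set [V(S)], prime exactly when [V(S)] is irreducible. *)
Definition IV S r : Prop := forall m, is_maximal m -> inV S m -> m r.

Lemma IV_ideal S : is_ideal (IV S).
Proof.
split=> [|x y hx hy|r x hx] m hm hS; have mI := maximal_ideal hm.
- exact: ideal0.
- by apply: idealD; [|exact: hx|exact: hy].
- by apply: idealM; [|exact: hx].
Qed.

(** If [a * b] vanishes on V(S) but neither factor does, adjoining [a] or [b] to [S] gives two
    proper closed subsets covering V(S). *)
Lemma IV_irreducible S :
  (forall S1 S2, V_lt S1 S -> V_lt S2 S ->
     (forall m, is_maximal m -> inV S m -> inV S1 m \/ inV S2 m) -> False) ->
  (exists m, is_maximal m /\ inV S m) -> is_prime (IV S).
Proof.
move=> irr [m0 [hm0 Sm0]]; split; first exact: IV_ideal.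
  by move=> /(_ _ hm0 Sm0); case: hm0.
move=> a b hab; apply: contrapT => nab.
have add c : ~ IV S c -> V_lt (fun x => S x \/ x = c) S.
  move=> nc; split=> [m hm h x Sx|]; first by apply: h; left.
  apply: contrapT => ex; apply: nc => m hm Sm; apply: contrapT => mc.
  by apply: ex; exists m; split=> // /(_ c) h; apply: mc; apply: h; right.
apply: (irr _ _ (add a _) (add b _)).
- by move=> ha; apply: nab; left.
- by move=> hb; apply: nab; right.
- move=> m hm Sm; have [_ _ mP] := maximal_prime hm.
  by case: (mP _ _ (hab m hm Sm)) => h; [left|right] => x [/Sm//|->].
Qed.

Lemma finite_V_union S S1 S2 : finite_V S1 -> finite_V S2 ->
  (forall m, is_maximal m -> inV S m -> inV S1 m \/ inV S2 m) -> finite_V S.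
Proof.
move=> [L1 h1] [L2 h2] h; exists (L1 ++ L2)%list => m hm Sm; apply: List.in_or_app.
by case: (h m hm Sm) => [/(h1 _ hm)|/(h2 _ hm)]; [left|right].
Qed.

Lemma finite_V_sub S T : (forall m, is_maximal m -> inV S m -> inV T m) ->
  finite_V T -> finite_V S.
Proof. by move=> ST [L h]; exists L => m hm /ST hS; apply: h => //; exact: hS. Qed.

Lemma V_lt_trans S T U : V_lt S T ->
  (forall m, is_maximal m -> inV T m -> inV U m) -> V_lt S U.
Proof.
move=> [h1 [m [hm Tm Sm]]] TU; split=> [m' hm' /(h1 _ hm')|]; first exact: TU.
by exists m; split=> //; exact: TU.
Qed.

Lemma infinite_V_ne S : ~ finite_V S -> exists m, is_maximal m /\ inV S m.
Proof.
move=> nf; apply: contrapT => ne; apply: nf; exists [::] => m hm Sm.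
by case: ne; exists m.
Qed.

Lemma infinite_V_avoid S L : ~ finite_V S ->
  exists m, [/\ is_maximal m, inV S m & ~ List.In m L].
Proof.
move=> nf; apply: contrapT => ne; apply: nf; exists L => m hm Sm.
by apply: contrapT => nL; apply: ne; exists m.
Qed.

(** By induction an infinite V(S) properly inside V(T) would be irreducible, since two smaller
    closed sets covering it are finite. Then [IV T], [IV S] and a point of V(S) form a chain of
    three primes. *)
Lemma irreducible_V_proper_finite T : krull_dim_le1 R -> mSpec_noetherian R ->
  is_prime (IV T) -> forall S, V_lt S T -> finite_V S.
Proof.
move=> dim noeth Tp; apply: (V_induction noeth) => S IH ST.
apply: contrapT => nf.
have Sp : is_prime (IV S).
  apply: IV_irreducible (infinite_V_ne nf) => S1 S2 lt1 lt2 h; apply: nf.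
  by apply: finite_V_union h; apply: IH => //; apply: V_lt_trans (ST.1).
(* The second point [m2] shows that [IV S] differs from [m1]: otherwise [m1] would lie in [m2]. *)
have [m1 [hm1 Sm1 _]] := infinite_V_avoid [::] nf.
have [m2 [hm2 Sm2 m12]] := infinite_V_avoid [:: m1] nf.
apply: (dim _ _ _ Tp Sp (maximal_prime hm1)).
  split=> [x Tx m hm Sm|]; first by apply: Tx => //; exact: ST.1.
  have [m [hm Tm nSm]] := ST.2.
  apply: contrapT => nx; apply: nSm => x Sx; apply: contrapT => mx.
  apply: nx; exists x; split=> [m' _|/(_ m hm Tm)//]; exact.
split=> [x|]; first exact.
apply: contrapT => nx; apply: m12; left; apply: maximal_sub => // x m1x.
by apply: contrapT => m2x; apply: nx; exists x; split=> // /(_ _ hm2 Sm2).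
Qed.

(* The test points [M] are one point outside [F] on each infinite irreducible component of mSpec. *)
Lemma test_points F : krull_dim_le1 R -> mSpec_noetherian R ->
  exists M, (forall m, List.In m M -> is_maximal m /\ ~ List.In m F) /\
    forall S, (forall m, List.In m M -> ~ inV S m) -> finite_V S.
Proof.
move=> dim noeth.
(* Relativising to closed subsets of V(T) allows induction on [T]; the empty set of equations gives
   all of mSpec R. *)
suff /(_ (fun=> False)) [M [MF hM]] : forall T, exists M,
    (forall m, List.In m M -> is_maximal m /\ ~ List.In m F) /\
    forall S, (forall m, is_maximal m -> inV S m -> inV T m) ->
      (forall m, List.In m M -> ~ inV S m) -> finite_V S.
  by exists M; split=> // S; apply: hM => m _ _ x.
apply: (V_induction noeth) => T IH.
case: (EM (finite_V T)) => [fT|nfT].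
  by exists [::]; split=> // S /finite_V_sub h _; exact: h.
case: (EM (is_prime (IV T))) => [Tp|nTp].
  have [m [hm Tm Fm]] := infinite_V_avoid F nfT.
  exists [:: m]; split=> [_ [<-|]//|S ST /(_ m (or_introl erefl)) nSm].
  by apply: (irreducible_V_proper_finite dim noeth Tp); split=> //; exists m.
have [S1 [S2 [lt1 lt2 h]]] : exists S1 S2, [/\ V_lt S1 T, V_lt S2 T &
    forall m, is_maximal m -> inV T m -> inV S1 m \/ inV S2 m].
  apply: contrapT => nS; apply: nTp; apply: IV_irreducible (infinite_V_ne nfT).
  by move=> S1 S2 h1 h2 h; apply: nS; exists S1, S2.
have [M1 [F1 h1]] := IH _ lt1; have [M2 [F2 h2]] := IH _ lt2.
exists (M1 ++ M2)%list; split=> [m /(@List.in_app_or _ _ _ _)[/F1|/F2]//|S ST hS].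
(* [SS X] cuts out the intersection of V(S) and V(X). *)
pose SS (X : R -> Prop) := fun x => S x \/ X x.
apply: (@finite_V_union S (SS S1) (SS S2)).
- apply: h1 => [m hm Sm x S1x|m Mm]; first by apply: Sm; right.
  by move=> SSm; apply: (hS m (List.in_or_app _ _ _ (or_introl Mm))) => x Sx; apply: SSm; left.
- apply: h2 => [m hm Sm x S1x|m Mm]; first by apply: Sm; right.
  by move=> SSm; apply: (hS m (List.in_or_app _ _ _ (or_intror Mm))) => x Sx; apply: SSm; left.
- move=> m hm Sm; case: (h m hm (ST m hm Sm)) => h'; [left|right] => x [/Sm//|];
  exact: h'.
Qed.

End Ideals.

(** * The ideal pA and subalgebras generated by a list *)

Section Fibers.
Variables (R : comPzRingType) (A : algType R).
Implicit Types (I p m : R -> Prop) (L F : seq (R -> Prop)) (a b x y : A) (c r u : R).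
Implicit Types (B : A -> Prop) (xs ys s : seq A).

Lemma in_pA0 p : in_pA p (0 : A).
Proof. by exists [::]; split=> //; rewrite big_nil. Qed.

Lemma in_pA_cons p c x a : p c -> in_pA p a -> in_pA p (c *: x + a).
Proof.
move=> pc [l [hl ->]]; exists ((c, x) :: l); rewrite big_cons; split=> //.
by move=> t [<-|/hl].
Qed.

Lemma in_pA_ind p (P : A -> Prop) : P 0 ->
  (forall c x a, p c -> P a -> P (c *: x + a)) -> forall a, in_pA p a -> P a.
Proof.
move=> P0 PS _ [l [+ ->]]; elim: l => [|[c x] l IH] hl; first by rewrite big_nil.
rewrite big_cons; apply: PS; first by apply: (hl (c, x)); left.
by apply: IH => t lt; apply: hl; right.
Qed.

Lemma in_pA_scale p c x : p c -> in_pA p (c *: x).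
Proof. by move=> pc; rewrite -[_ *: _]addr0; apply: in_pA_cons (in_pA0 p). Qed.

Lemma in_pAD p a b : in_pA p a -> in_pA p b -> in_pA p (a + b).
Proof.
move=> + pb; move: a; apply: in_pA_ind => [|c x a pc IH]; first by rewrite add0r.
by rewrite -addrA; exact: in_pA_cons.
Qed.

Lemma in_pAZ p r a : in_pA p a -> in_pA p (r *: a).
Proof.
move: a; apply: in_pA_ind => [|c x a pc IH]; first by rewrite scaler0; exact: in_pA0.
by rewrite scalerDr scalerA mulrC -scalerA; exact: in_pA_cons.
Qed.

Lemma in_pAN p a : in_pA p a -> in_pA p (- a).
Proof. by rewrite -scaleN1r; exact: in_pAZ. Qed.

Lemma in_pAMl p b a : in_pA p a -> in_pA p (b * a).
Proof.
move: a; apply: in_pA_ind => [|c x a pc IH]; first by rewrite mulr0; exact: in_pA0.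
by rewrite mulrDr -scalerAr; exact: in_pA_cons.
Qed.

Lemma in_pAMr p b a : in_pA p a -> in_pA p (a * b).
Proof.
move: a; apply: in_pA_ind => [|c x a pc IH]; first by rewrite mul0r; exact: in_pA0.
by rewrite mulrDl -scalerAl; exact: in_pA_cons.
Qed.

Lemma in_pA_cancel m u a : is_maximal m -> ~ m u -> in_pA m (u *: a) -> in_pA m a.
Proof.
move=> hm nu hu; have [v hv] := maximal_inv hm nu.
have -> : a = v *: (u *: a) + (1 - u * v) *: a.
  by rewrite scalerBl scale1r scalerA [u * v]mulrC addrCA subrr addr0.
by apply: in_pAD; [exact: in_pAZ|exact: in_pA_scale].
Qed.

(** Closure rules replace sums of monomials to allow induction; [gen_alg_gen] translates back. *)
Inductive gen (xs : seq A) : A -> Prop :=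
| gen_mem a of a \in xs : gen xs a
| gen1 : gen xs 1
| genD a b of gen xs a & gen xs b : gen xs (a + b)
| genM a b of gen xs a & gen xs b : gen xs (a * b)
| genZ c a of gen xs a : gen xs (c *: a).

Lemma gen0 xs : gen xs 0.
Proof. by rewrite -(scale0r 1); apply: genZ; exact: gen1. Qed.

Lemma gen_alg_gen xs : (forall a, gen xs a) -> alg_gen A (size xs).
Proof.
move=> hgen; exists (fun i => xs`_i) => a; elim: (hgen a) => {a}.
- move=> a axs; have ia : (index a xs < size xs)%N by rewrite index_mem.
  exists [:: (1, [:: Ordinal ia])]; rewrite big_seq1 scale1r /monomial big_seq1 /=.
  by rewrite nth_index.
- by exists [:: (1, [::])]; rewrite big_seq1 scale1r /monomial big_nil.
- by move=> a b _ [l ->] _ [l' ->]; exists (l ++ l'); rewrite big_cat.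
- move=> a b _ [l ->] _ [l' ->].
  exists [seq (t.1 * t'.1, t.2 ++ t'.2) | t <- l, t' <- l'].
  rewrite big_distrlr /= big_allpairs_dep; apply: eq_bigr => t _; apply: eq_bigr => t' _.
  by rewrite /monomial big_cat /= -scalerAl -scalerAr scalerA.
- move=> c a _ [l ->]; exists [seq (c * t.1, t.2) | t <- l].
  by rewrite big_map scaler_sumr; apply: eq_bigr => t _; rewrite scalerA.
Qed.

(** Membership in a subalgebra of A/mA, expressed on lifts to A. *)
Definition gen_mod m xs a : Prop := exists2 b, gen xs b & in_pA m (a - b).
Definition generates m xs : Prop := forall a, gen_mod m xs a.

Lemma gen_gen_mod m xs a : gen xs a -> gen_mod m xs a.
Proof. by move=> ga; exists a => //; rewrite subrr; exact: in_pA0. Qed.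

Lemma gen_mod_congr m xs a b : in_pA m (a - b) -> gen_mod m xs b -> gen_mod m xs a.
Proof.
by move=> ab [d gd bd]; exists d => //; rewrite -(subrK b a) -addrA; exact: in_pAD.
Qed.

Lemma gen_mod_sub m xs ys a : (forall x, x \in xs -> gen_mod m ys x) ->
  gen_mod m xs a -> gen_mod m ys a.
Proof.
move=> h [b gb ab]; apply: gen_mod_congr ab _; elim: gb => {a b}.
- exact: h.
- by apply: gen_gen_mod; exact: gen1.
- move=> a b _ [a' ga ha] _ [b' gb hb]; exists (a' + b'); first exact: genD.
  by rewrite opprD addrACA; exact: in_pAD.
- move=> a b _ [a' ga ha] _ [b' gb hb]; exists (a' * b'); first exact: genM.
  have -> : a * b - a' * b' = (a - a') * b + a' * (b - b').
    by rewrite mulrBl mulrBr addrA subrK.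
  by apply: in_pAD; [exact: in_pAMr|exact: in_pAMl].
- move=> c a _ [a' ga ha]; exists (c *: a'); first exact: genZ.
  by rewrite -scalerBr; exact: in_pAZ.
Qed.

(** * Nakayama's lemma and generation from local to global *)

Definition submodule B : Prop :=
  [/\ B 0, (forall a b, B a -> B b -> B (a + b)) & (forall c a, B a -> B (c *: a))].

Lemma gen_submodule xs : submodule (gen xs).
Proof. by split; [exact: gen0|exact: genD|exact: genZ]. Qed.

(** Membership in [B + I s_1 + ... + I s_n], in a recursive form suited to eliminating one generator
    at a time. *)
Fixpoint comb I B s a : Prop :=
  if s is x :: s' then exists2 c, I c & comb I B s' (a - c *: x) else B a.

Section Comb.
Variables (I : R -> Prop) (B : A -> Prop).
Hypotheses (II : is_ideal I) (BB : submodule B).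

Lemma combB s a : B a -> comb I B s a.
Proof.
elim: s a => //= x s IH a Ba; exists 0; first exact: ideal0.
by rewrite scale0r subr0; exact: IH.
Qed.

Lemma combD s a b : comb I B s a -> comb I B s b -> comb I B s (a + b).
Proof.
elim: s a b => [|x s IH] a b /=; first by case: BB => _ + _; apply.
move=> [c Ic hc] [d Id hd]; exists (c + d); first exact: idealD.
by rewrite scalerDl opprD addrACA; exact: IH.
Qed.

Lemma combZ s r a : comb I B s a -> comb I B s (r *: a).
Proof.
elim: s a => [|x s IH] a /=; first by case: BB => _ _; apply.
move=> [c Ic hc]; exists (r * c); first exact: idealM.
by rewrite -scalerA -scalerBr; exact: IH.
Qed.

Lemma comb_scale s c x : I c -> x \in s -> comb I B s (c *: x).
Proof.
move=> Ic; elim: s => //= y s IH; rewrite inE => /orP[/eqP <-|xs].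
  by exists c => //; rewrite subrr; apply: combB; case: BB.
by exists 0; [exact: ideal0|rewrite scale0r subr0; exact: IH].
Qed.

End Comb.

(* Nakayama's lemma localized at [p]: eliminating the generators one at a time
   multiplies the remaining relations by [u - c], which stays outside [p]. *)
Lemma nakayama_at p B s : is_prime p -> submodule B ->
  (forall x, x \in s -> exists2 u, ~ p u & comb p B s (u *: x)) ->
  exists2 u, ~ p u & forall x, x \in s -> B (u *: x).
Proof.
move=> hp BB; have pI := prime_ideal hp.
elim: s => [|x s IH] h; first by exists 1 => //; case: hp.
have [u nu [c pc hc]] := h x (mem_head x s).
rewrite -scalerBl in hc; set v := u - c in hc.
have nv : ~ p v by move=> pv; apply: nu; rewrite -(subrK c u); exact: idealD.
have [y ys|w nw hw] := IH.
  have [|u' nu' [c' pc' hc']] := h y; first by rewrite inE ys orbT.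
  exists (v * u'); first exact: prime_notM.
  (* After multiplication by [v] the term in [x] involves only [v *: x], already a combination of
     the remaining generators. *)
  have -> : (v * u') *: y = v *: (u' *: y - c' *: x) + c' *: (v *: x).
    by rewrite scalerBr !scalerA [c' * v]mulrC subrK.
  by apply: combD => //; exact: combZ.
exists (w * v); first exact: prime_notM.
have [B0 BD BZ] := BB.
move=> y; rewrite inE => /orP[/eqP ->|ys]; last first.
  by rewrite mulrC -scalerA; apply: BZ; exact: hw.
(* Back substitution: [w] carries every element of [s] into [B], hence also the combination
   [v *: x]. *)
rewrite -scalerA; move: (v *: x) hc => z {h IH}.
elim: s hw z => [|y' s IH] hw z /=; first exact: BZ.
move=> [d _ hd].
have -> : w *: z = w *: (z - d *: y') + d *: (w *: y').
  by rewrite scalerBr !scalerA [d * w]mulrC subrK.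
apply: BD; last by apply: BZ; apply: hw; exact: mem_head.
by apply: IH hd => // y'' ys; apply: hw; rewrite inE ys orbT.
Qed.

(** Nakayama for A modulo the subalgebra of [xs], localized at [m]: one denominator [u] serves all
    of A because A is a finite module. *)
Lemma generates_spread (hfg : fg_module A) m xs : is_maximal m -> generates m xs ->
  exists2 u, ~ m u & forall a, gen xs (u *: a).
Proof.
move=> hm gm; have [s hs] := hfg; have BB := gen_submodule xs.
have mI := maximal_ideal hm.
have CD := combD mI BB (s := s); have CZ := combZ mI BB (s := s).
have C0 : comb m (gen xs) s 0 by apply: combB => //; exact: gen0.
have [x xs_s|u nu hu] := nakayama_at (maximal_prime hm) BB (s := s).
  exists 1; [by case: hm|rewrite scale1r].
  have [b gb] := gm x; rewrite -{2}(subrK b x); move: (x - b) => z hz.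
  apply: (CD); last exact: combB.
  move: z hz; apply: in_pA_ind => // c y a mc ha; apply: (CD) => //.
  have [d ->] := hs y; rewrite scaler_sumr.
  elim/big_rec: _ => // i w _ hw; apply: (CD) => //; rewrite scalerA mulrC -scalerA.
  by apply: CZ; apply: comb_scale => //; exact: mem_nth.
exists u => // a; have [d ->] := hs a; rewrite scaler_sumr.
elim/big_rec: _ => [|i w _ hw]; first exact: gen0.
by apply: genD => //; rewrite scalerA mulrC -scalerA; apply: genZ; apply: hu; exact: mem_nth.
Qed.

(** The [u] with [uA] inside the subalgebra form an ideal [J]; by [generates_spread] no maximal
    ideal contains it, so it contains 1. *)
Lemma generates_global (hfg : fg_module A) xs :
  (forall m, is_maximal m -> generates m xs) -> forall a, gen xs a.
Proof.
move=> h; pose J u := forall a, gen xs (u *: a).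
have hJ : is_ideal J.
  split=> [a|u v hu hv a|r u hu a].
  - by rewrite scale0r; exact: gen0.
  - by rewrite scalerDl; exact: genD.
  - by rewrite -scalerA; exact: genZ.
move=> a; rewrite -(scale1r a); apply: contrapT => n1.
have [m [hm Jm]] := exists_maximal hJ (fun J1 => n1 (J1 a)).
by have [u nu hu] := generates_spread hfg hm (h m hm); apply: nu; exact: Jm.
Qed.

Lemma gen_scale_generates m u xs : is_maximal m -> ~ m u ->
  (forall a, gen xs (u *: a)) -> generates m xs.
Proof.
move=> hm nu hu a; have [v hv] := maximal_inv hm nu.
exists ((u * v) *: a); first by rewrite -scalerA; exact: hu.
by rewrite -{1}(scale1r a) -scalerBl; exact: in_pA_scale.
Qed.

(** * Counting the generators still needed *)

(** The inequality [c_m(xs) <= t]; by [extends_leq], exactly [t] elements and at most [t] elements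
    amount to the same. *)
Definition extends m xs t : Prop :=
  exists ys, size ys = t /\ generates m (xs ++ ys).

(** Upper semicontinuity: the same additional elements work at every maximal ideal omitting [u]. *)
Lemma extends_open (hfg : fg_module A) m xs t : is_maximal m -> extends m xs t ->
  exists2 u, ~ m u & forall m', is_maximal m' -> ~ m' u -> extends m' xs t.
Proof.
move=> hm [ys [<- g]]; have [u nu hu] := generates_spread hfg hm g.
by exists u => // m' hm' nu'; exists ys; split=> //; exact: gen_scale_generates hu.
Qed.

Lemma generates_sub m xs ys : {subset xs <= ys} -> generates m xs -> generates m ys.
Proof.
move=> xy g a; apply: gen_mod_sub (g a) => x xxs.
by apply: gen_gen_mod; apply: gen_mem; exact: xy.
Qed.

Lemma extends_leq m xs t t' : (t <= t')%N -> extends m xs t -> extends m xs t'.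
Proof.
move=> tt' [ys [sy g]]; exists (ys ++ nseq (t' - t) 0).
(* Zeros pad the list to the exact length. *)
rewrite size_cat size_nseq sy subnKC //; split=> //; apply: generates_sub g => x.
by rewrite !mem_cat orbA => ->.
Qed.

Lemma extends_rcons m xs x t : extends m xs t -> extends m (rcons xs x) t.
Proof.
move=> [ys [sy g]]; exists ys; split=> //; apply: generates_sub g => y.
by rewrite -cats1 !mem_cat => /orP[] ->; rewrite ?orbT.
Qed.

(** Only the class of the next element modulo [mA] matters, so choices at several [m] can be merged
    by [crt]. *)
Lemma extends_step m xs t : extends m xs t.+1 ->
  exists x, forall x', in_pA m (x' - x) -> extends m (rcons xs x') t.
Proof.
move=> [[|x ys] [//= [sy] g]]; exists x => x' xx'; exists ys; split=> // a.
apply: gen_mod_sub (g a) => y; rewrite mem_cat inE => /or3P[yxs|/eqP ->|yys].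
- by apply: gen_gen_mod; apply: gen_mem; rewrite cat_rcons mem_cat yxs.
- apply: (@gen_mod_congr _ _ _ x'); first by rewrite -opprB; exact: in_pAN.
  by apply: gen_gen_mod; apply: gen_mem; rewrite cat_rcons mem_cat mem_head orbT.
- by apply: gen_gen_mod; apply: gen_mem; rewrite cat_rcons mem_cat inE yys !orbT.
Qed.

(** Ideals are added one at a time: [a] is corrected at the new [m] by a multiple of an [e] that is
    1 modulo [m] and lies in the other maximal ideals. *)
Lemma crt L (f : (R -> Prop) -> A) :
  exists a, forall m, List.In m L -> is_maximal m -> in_pA m (a - f m).
Proof.
elim: L => [|m L [a ha]]; first by exists 0.
case: (EM (is_maximal m)) => [hm|nm]; last first.
  by exists a => m' [<-|/ha].
case: (EM (List.In m L)) => [mL|nmL].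
  by exists a => m' [<-|]; exact: ha.
have [e [e1 eL]] := crt_element L hm.
exists (a + e *: (f m - a)) => m' [<- _|Lm' hm'].
  have -> : a + e *: (f m - a) - f m = (1 - e) *: (a - f m).
    by rewrite scalerBl scale1r -(opprB a (f m)) scalerN addrAC.
  exact: in_pA_scale.
rewrite addrAC; apply: in_pAD; first exact: ha.
by apply: in_pA_scale; apply: eL => // E; apply: nmL; rewrite -E.
Qed.

Lemma extends_step_crt xs L (t : (R -> Prop) -> nat) :
  (forall m, List.In m L -> is_maximal m -> extends m xs (t m).+1) ->
  exists x, forall m, List.In m L -> is_maximal m -> extends m (rcons xs x) (t m).
Proof.
move=> h.
have /choice[f hf] : forall m, exists y, List.In m L -> is_maximal m ->
    forall x', in_pA m (x' - y) -> extends m (rcons xs x') (t m).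
  move=> m; case: (EM (List.In m L /\ is_maximal m)) => [[Lm hm]|n].
    by have [y hy] := extends_step (h m Lm hm); exists y.
  by exists 0 => Lm hm; case: n.
have [x hx] := crt L f; exists x => m Lm hm; exact: hf (hx m Lm hm).
Qed.

(** The intersection of the maximal ideals where [t] more elements do not suffice. By openness these
    are exactly the points of its closed set. *)
Definition nonextending xs t r : Prop :=
  forall m, is_maximal m -> ~ extends m xs t -> m r.

Lemma nonextending_V (hfg : fg_module A) xs t m : is_maximal m ->
  inV (nonextending xs t) m -> ~ extends m xs t.
Proof.
move=> hm Vm /(extends_open hfg hm)[u nu hu]; apply: nu; apply: Vm => m' hm' ne.
by apply: contrapT => nu'; apply: ne; exact: hu.
Qed.

(** Induction on [t], lowering [t] and [e] together while the finite exceptional set changes; the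
    gap [t < e] is preserved. *)
Lemma complete_generators (hfg : fg_module A) (hdim : krull_dim_le1 R)
    (hnoeth : mSpec_noetherian R) t e xs F : (t < e)%N ->
  (forall m, is_maximal m -> ~ List.In m F -> extends m xs t) ->
  (forall m, is_maximal m -> extends m xs e) ->
  exists ys, size ys = e /\ forall m, is_maximal m -> generates m (xs ++ ys).
Proof.
elim: t e xs F => [|t IH] [//|e] xs F te hF hall.
  have {te} : forall m, is_maximal m -> ~ List.In m F -> generates m xs.
    by move=> m hm /(hF m hm)[ys [/size0nil -> ]]; rewrite cats0.
  (* Off [F] the list already generates, so each further element is prescribed only on [F]. *)
  move: hall; elim: e.+1 xs {hF} => {e} [|e IH] xs hall hF.
    by exists [::]; split=> // m /hall[ys [/size0nil ->]].
  have [x hx] := @extends_step_crt xs F (fun=> e) (fun m _ => hall m).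
  have hF' m : is_maximal m -> ~ List.In m F -> generates m (rcons xs x).
    move=> hm nF; apply: generates_sub (hF m hm nF) => y.
    by rewrite mem_rcons inE => ->; rewrite orbT.
  have [m hm|ys [sy hys]] := IH (rcons xs x) _ hF'.
    case: (EM (List.In m F)) => [mF|nF]; first exact: hx.
    exists (nseq e 0); rewrite size_nseq; split=> //.
    by apply: generates_sub (hF' m hm nF) => y; rewrite mem_cat => ->.
  by exists (x :: ys); rewrite /= sy -cat_rcons.
have [M [MF hM]] := test_points F hdim hnoeth.
(* Targets after adding [x]: [t] at the test points, where [t.+1] sufficed before, and [e] on
   [F]. *)
pose d m := if `[< List.In m M >] then t else e.
have [m FM hm|x hx] := @extends_step_crt xs (F ++ M)%list d.
  rewrite /d; case: asboolP => [Mm|_]; last exact: hall.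
  by apply: hF => //; case: (MF m Mm).
(* The new bad set is closed and misses every test point, hence is finite; it becomes the next
   exceptional set. *)
have [|F' hF'] := hM (nonextending (rcons xs x) t).
  move=> m Mm; have [hm _] := MF m Mm; move/(nonextending_V hfg hm); apply.
  have := hx m (List.in_or_app _ _ _ (or_intror Mm)) hm.
  by rewrite /d; case: asboolP.
have [m hm nF'|m hm|ys [sy hys]] := IH e (rcons xs x) F' te.
- by apply: contrapT => ne; apply: nF'; apply: hF' => // r; apply.
(* Off [F] the old bound [t.+1] is kept, and [t < e] makes it at most [e], even at the new bad
   points. *)
- case: (EM (List.In m F)) => [mF|nF]; last first.
    by apply: extends_leq (extends_rcons x (hF m hm nF)).
  have := hx m (List.in_or_app _ _ _ (or_introl mF)) hm.
  by rewrite /d; case: asboolP => // _; apply: extends_leq; exact: ltnW.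
- by exists (x :: ys); rewrite /= sy -cat_rcons.
Qed.

(** * Fractions in the fibre and their representatives in A *)

(** [b : A] represents the fraction [z] in A ⊗ κ(p); when [p] is maximal every
    fraction has such a representative. *)
Definition fib_value p (z : A * R) b : Prop := ~ p z.2 /\ in_pA p (z.1 - z.2 *: b).

Lemma fib_value_zero p : is_prime p -> fib_value p (fib_zero A) 0.
Proof. by case=> _ p1 _; split=> //=; rewrite scaler0 subrr; exact: in_pA0. Qed.

Lemma fib_value_one p : is_prime p -> fib_value p (fib_one A) 1.
Proof. by case=> _ p1 _; split=> //=; rewrite scale1r subrr; exact: in_pA0. Qed.

Lemma fib_value_add p (y z : A * R) a b : is_prime p ->
  fib_value p y a -> fib_value p z b -> fib_value p (fib_add y z) (a + b).
Proof.
case: y z => [a1 c] [b1 d] hp [/= nc ha] [/= nd hb]; split; first exact: prime_notM.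
have -> : d *: a1 + c *: b1 - (c * d) *: (a + b) = d *: (a1 - c *: a) + c *: (b1 - d *: b).
  by rewrite !scalerBr scalerDr !scalerA [d * c]mulrC opprD addrACA.
by apply: in_pAD; exact: in_pAZ.
Qed.

Lemma fib_value_mul p (y z : A * R) a b : is_prime p ->
  fib_value p y a -> fib_value p z b -> fib_value p (fib_mul y z) (a * b).
Proof.
case: y z => [a1 c] [b1 d] hp [/= nc ha] [/= nd hb]; split; first exact: prime_notM.
have -> : a1 * b1 - (c * d) *: (a * b) = (a1 - c *: a) * b1 + (c *: a) * (b1 - d *: b).
  by rewrite mulrBl mulrBr addrA subrK -scalerAl -scalerAr scalerA.
by apply: in_pAD; [exact: in_pAMr|exact: in_pAMl].
Qed.

(** The condition [p (c - d * e)] says that [e] represents [c/d] in κ(p). *)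
Lemma fib_value_scale p c d e (z : A * R) b : is_prime p -> ~ p d -> p (c - d * e) ->
  fib_value p z b -> fib_value p (fib_scale (c, d) z) (e *: b).
Proof.
case: z => [a1 f] hp nd hc [/= nf hb]; split; first exact: prime_notM.
have -> : c *: a1 - (d * f) *: (e *: b) = c *: (a1 - f *: b) + (c - d * e) *: (f *: b).
  by rewrite scalerBr scalerBl !scalerA addrA subrK mulrAC.
by apply: in_pAD; [exact: in_pAZ|exact: in_pA_scale].
Qed.

Lemma fib_value_exists m (z : A * R) : is_maximal m -> ~ m z.2 -> exists b, fib_value m z b.
Proof.
case: z => [a d] hm /= nd; have [e he] := maximal_inv hm nd.
exists (e *: a); split=> //=.
by rewrite scalerA -{1}(scale1r a) -scalerBl; exact: in_pA_scale.
Qed.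

Lemma fib_value_eq p (y z : A * R) b : fib_value p y b -> fib_value p z b -> is_prime p ->
  fib_eq p y z.
Proof.
case: y z => [a1 c] [b1 d] [/= nc ha] [/= nd hb] hp; exists 1; split; first by case: hp.
rewrite scale1r /=.
have -> : d *: a1 - c *: b1 = d *: (a1 - c *: b) - c *: (b1 - d *: b).
  by rewrite !scalerBr !scalerA [d * c]mulrC opprB addrA subrK.
by apply: in_pAD; [exact: in_pAZ|apply: in_pAN; exact: in_pAZ].
Qed.

(** Generators of the fibre are replaced by representatives in A; each sum of monomials then has a
    value in their subalgebra, and denominators cancel modulo [m]. *)
Lemma fib_alg_gen_generates m n : is_maximal m -> fib_alg_gen A m n ->
  exists xs, size xs = n /\ generates m xs.
Proof.
move=> hm [y [ny hy]]; have mP := maximal_prime hm.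
have [b hb] := choice (fun i => fib_value_exists hm (ny i)).
pose xs := [seq b i | i <- enum 'I_n]; exists xs; split; first by rewrite size_map size_enum_ord.
have bxs i : b i \in xs by apply: map_f; rewrite mem_enum.
move=> a; have [|l [hl]] := hy (a, 1); first by case: mP.
suff [w gw [nw hw]] : exists2 w, gen xs w & fib_value m (foldr (fun t acc =>
    fib_add (fib_scale t.1 (fib_monomial y t.2)) acc) (fib_zero A) l) w.
  case: (foldr _ _ _) nw hw => [w1 d] /= nd hw [u [nu]] /=.
  rewrite scale1r => hu; exists w => //; apply: (in_pA_cancel hm nd).
  rewrite scalerBr -(subrK w1 (d *: a)) -addrA; apply: in_pAD => //.
  exact: in_pA_cancel nu hu.
elim: l hl => [|[[c d] v] l IH] hl /=.
  by exists 0; [exact: gen0|exact: fib_value_zero].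
have [|w gw hw] := IH; first by move=> t lt; apply: hl; right.
have nd : ~ m d by apply: (hl ((c, d), v)); left.
have [e he] := maximal_inv hm nd.
have [z gz hz] : exists2 z, gen xs z & fib_value m (fib_monomial y v) z.
  elim: v {hl} => [|i v [z gz hz]]; first by exists 1; [exact: gen1|exact: fib_value_one].
  exists (b i * z); first by apply: genM => //; exact: gen_mem.
  exact: fib_value_mul.
exists ((e * c) *: z + w); first by apply: genD => //; exact: genZ.
apply: fib_value_add => //; apply: fib_value_scale => //.
have -> : c - d * (e * c) = c * (1 - d * e) by rewrite mulrBr mulr1 mulrA [c * _]mulrC.
by apply: idealM => //; exact: maximal_ideal.
Qed.

(** Module generators of A generate every fibre, which bounds all [r_m] uniformly and yields the
    existence of [r_m] and [h]. *)
Lemma fg_fib_alg_gen s m :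
  (forall a, exists c : 'I_(size s) -> R, a = \sum_(i < size s) c i *: s`_i) ->
  is_maximal m -> fib_alg_gen A m (size s).
Proof.
move=> hs hm; have mP := maximal_prime hm; have mI := maximal_ideal hm.
exists (fun i => (s`_i, 1)); split=> [i|[a d] /= nd]; first by case: mP.
have [c ->] := hs a; have [e he] := maximal_inv hm nd.
exists [seq ((c i, d), [:: i]) | i <- enum 'I_(size s)]; split.
  by move=> t /List.in_map_iff[i [<-]].
have hsum : fib_value m (foldr (fun t acc => fib_add (fib_scale t.1
      (fib_monomial (fun i : 'I_(size s) => (s`_i, 1)) t.2)) acc) (fib_zero A)
      [seq ((c i, d), [:: i]) | i <- enum 'I_(size s)])
    (\sum_(i <- enum 'I_(size s)) (e * c i) *: s`_i).
  elim: (enum _) => [|i r IH]; first by rewrite big_nil; exact: fib_value_zero.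
  rewrite big_cons; apply: fib_value_add => //; apply: fib_value_scale => //.
    have -> : c i - d * (e * c i) = c i * (1 - d * e).
      by rewrite mulrBr mulr1 mulrA [c i * _]mulrC.
    exact: idealM.
  rewrite -[s`_i]mulr1; apply: fib_value_mul (fib_value_one mP) => //.
  by split; [case: mP|rewrite /= scale1r subrr; exact: in_pA0].
apply: fib_value_eq hsum mP; split=> //=; rewrite big_enum /= scaler_sumr -sumrB.
apply: big_ind => [|x y hx hy|i _]; [exact: in_pA0|exact: in_pAD|].
have -> : c i *: s`_i - d *: ((e * c i) *: s`_i) = (c i * (1 - d * e)) *: s`_i.
  by rewrite scalerA -scalerBl mulrBr mulr1 mulrA [c i * _]mulrC.
by apply: in_pA_scale; exact: idealM.
Qed.

Lemma extends_nil m (r t : nat) : is_maximal m -> is_rp A m r -> (r <= t)%N -> extends m [::] t.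
Proof.
move=> hm [hr _] rt; apply: extends_leq rt _.
by have [xs [sx g]] := fib_alg_gen_generates hm hr; exists xs.
Qed.
End Fibers.

(** * Existence of the minimal numbers and conclusion *)

Lemma least_nat (P : nat -> Prop) n : P n -> exists m, P m /\ forall k, P k -> (m <= k)%N.
Proof.
move=> Pn; have ex : exists m, `[< P m >] by exists n; exact/asboolP.
case: (ex_minnP ex) => m /asboolP Pm hm; exists m; split=> // k Pk.
by apply: hm; exact/asboolP.
Qed.

Theorem mainTheorem5 (R : comPzRingType) (A : algType R)
  (hdim : krull_dim_le1 R) (hnoeth : mSpec_noetherian R)
  (hfg : fg_module A) (k : nat)
  (hk_all : forall p, is_maximal p -> forall r, is_rp A p r -> (r <= k)%N)
  (hk_h : forall h, is_h A h -> (1 + h <= k)%N) :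
  alg_gen A k.
Proof.
have [s hs] := hfg.
(* The number of module generators is a bound with no exceptional ideals, so a least bound
   exists. *)
have [h hh] : exists h, is_h A h.
  apply: (@least_nat _ (size s)); exists [::] => p hp _ r [_ hr].
  exact: hr (fg_fib_alg_gen hs hp).
have [F hF] := hh.1.
have rp m : is_maximal m -> exists r, is_rp A m r.
  by move=> hm; exact: least_nat (fg_fib_alg_gen hs hm).
(* Start from the empty list with [t = h] and [e = k]; [1 + h <= k] is the required [h < k]. *)
have [m hm nF|m hm|ys [sy hys]] :=
  @complete_generators R A hfg hdim hnoeth h k [::] F (hk_h h hh).
- have [r hr] := rp m hm; apply: (extends_nil hm hr); apply: hF hr => //.
  by move=> [q [qF mq]]; apply: nF; have -> : m = q by rewrite predeqE.
- by have [r hr] := rp m hm; apply: (extends_nil hm hr); exact: hk_all hr.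
- by rewrite -sy; apply: gen_alg_gen; exact: generates_global.
Qed.
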